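(* Let $(X,d)$ be a complete $b$-metric space with constant $s\in[1,\infty)$ and let $T:X\to\mathcal{B}(X)$ be a function such that: (i) there exist $c,\delta\in[0,1]$ and $\alpha\in[0,1)$ such that $h(T(x),T(y))\le\alpha N_{c,\delta}(x,y)$ for all $x,y\in X$; (ii) $\max\{\alpha c s,\ \alpha\delta s\}<1$ (for the constants $\alpha,c,\delta$ of (i)). Then $T$ has a fixed point, i.e. there exists $u\in X$ with $u\in T(u)$.
   Context: Given a nonempty set $X$ and a real number $s\in[1,\infty)$, a function $d:X\times X\to[0,\infty)$ is called a $b$-metric (with constant $s$) if for all $x,y,z\in X$: (i) $d(x,y)=0$ if and only if $x=y$; (ii) $d(x,y)=d(y,x)$; (iii) $d(x,y)\le s(d(x,z)+d(z,y))$. The pair $(X,d)$ is called a $b$-metric space. A sequence $(x_n)_{n\in\mathbb{N}}$ in $X$ is convergent to $l\in X$ (written $\lim_{n\to\infty}x_n=l$) if $\lim_{n\to\infty}d(x_n,l)=0$; it is Cauchy if for every $\varepsilon>0$ there exists $n_\varepsilon\in\mathbb{N}$ such that $d(x_m,x_n)<\varepsilon$ for all $m,n\ge n_\varepsilon$. $(X,d)$ is complete if every Cauchy sequence is convergent. The space carries the topology induced by this convergence: a subset is closed if it contains the limit of each convergent sequence of its elements. $\mathcal{B}(X)$ denotes the set of non-empty bounded closed subsets of $X$ (bounded meaning that $d$ is bounded on pairs of elements of the subset). For $x\in X$ and $C\in\mathcal{B}(X)$, $d(x,C)=\inf_{c\in C}d(x,c)$. For $A,B\in\mathcal{B}(X)$,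 $h(A,B)=\max\{\sup_{a\in A}d(a,B),\ \sup_{b\in B}d(b,A)\}$. For constants $c,\delta\in[0,1]$ and $x,y\in X$, $$N_{c,\delta}(x,y)=\max\Big\{d(x,y),\ c\,d(x,T(x)),\ c\,d(y,T(y)),\ \tfrac{\delta}{2}\big(d(x,T(y))+d(y,T(x))\big)\Big\}.$$ *)

(* Defs.v *)
From mathcomp Require Import all_boot all_order all_algebra.
From mathcomp Require Import all_classical all_reals all_analysis.

Set Implicit Arguments.
Unset Strict Implicit.
Unset Printing Implicit Defensive.

Import Order.TTheory GRing.Theory Num.Theory.
Import numFieldNormedType.Exports.

Local Open Scope classical_set_scope.
Local Open Scope ring_scope.

Definition is_bmetric (R : realType) (X : Type) (s : R) (d : X -> X -> R) : Prop :=
  [/\ forall x y, 0 <= d x y,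
      forall x y, d x y = 0 <-> x = y,
      forall x y, d x y = d y x
    & forall x y z, d x y <= s * (d x z + d z y)].

(* A b-metric need not be continuous and its balls need not be open, so
   convergence, the Cauchy property and closedness are all defined directly from
   [d] and sequences, not through a metric or uniform structure on [X]. *)
Definition bconverges (R : realType) (X : Type) (d : X -> X -> R)
    (u : nat -> X) (l : X) : Prop :=
  (fun n => d (u n) l) @ \oo --> (0 : R).

Definition bcauchy (R : realType) (X : Type) (d : X -> X -> R)
    (u : nat -> X) : Prop :=
  forall e : R, 0 < e ->
    exists N : nat, forall m n : nat, (N <= m)%N -> (N <= n)%N -> d (u m) (u n) < e.

Definition bcomplete (R : realType) (X : Type) (d : X -> X -> R) : Prop :=
  forall u : nat -> X, bcauchy d u -> exists l : X, bconverges d u l.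

Definition bclosed (R : realType) (X : Type) (d : X -> X -> R) (A : set X) : Prop :=
  forall (u : nat -> X) (l : X), (forall n, A (u n)) -> bconverges d u l -> A l.

Definition bbounded (R : realType) (X : Type) (d : X -> X -> R) (A : set X) : Prop :=
  exists M : R, forall x y, A x -> A y -> d x y <= M.

Definition closed_bounded_sets (R : realType) (X : Type) (d : X -> X -> R) :
    set (set X) :=
  [set A | [/\ A !=set0, bbounded d A & bclosed d A]].

Definition dist_to_set (R : realType) (X : Type) (d : X -> X -> R)
    (x : X) (C : set X) : R :=
  inf [set d x c | c in C].

(* [inf] and [sup] return 0 on empty or unbounded sets. This does not occur
   for members of [closed_bounded_sets d]: the infimum is over a nonempty set
   bounded below by 0, and with [b0] in [B] and [a0] in [A] one has
   [dist_to_set d a B <= d a b0 <= s * (d a a0 + d a0 b0)], which is bounded for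
   [a] in [A]. *)
Definition hausdorff_dist (R : realType) (X : Type) (d : X -> X -> R)
    (A B : set X) : R :=
  Num.max (sup [set dist_to_set d a B | a in A])
          (sup [set dist_to_set d b A | b in B]).

Definition Nmax (R : realType) (X : Type) (d : X -> X -> R) (T : X -> set X)
    (c delta : R) (x y : X) : R :=
  Num.max (d x y)
    (Num.max (c * dist_to_set d x (T x))
      (Num.max (c * dist_to_set d y (T y))
        (delta / 2 * (dist_to_set d x (T y) + dist_to_set d y (T x))))).

(* Main.v *)
Require Import Defs.
From mathcomp Require Import all_boot all_order all_algebra.
From mathcomp Require Import all_classical all_reals all_analysis.
From mathcomp Require Import lra.

(** The fixed point is the limit of an orbit [x n.+1 \in T (x n)] along which
    the steps [d (x n) (x n.+1)] shrink geometrically.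

    Enlarging [alpha] slightly to [beta] leaves room to choose, for [y] in
    [T x], some [z] in [T y] with [d y z] below [beta * Nmax x y].  The terms
    of [Nmax] that involve [d y z] itself can then be absorbed, because
    [beta * c] and [beta * delta * s] are still below 1; what remains is
    [d y z <= k * d x y] with [k < 1] ([contraction_step]).

    The usual telescoping bound for such an orbit would require [s * k < 1].
    Grouping the steps into blocks of a length [p] with [s * k ^+ p <= 1 / 2]
    pays the constant [s] once per block, so any [k < 1] gives a Cauchy
    sequence ([geometric_cauchy]).

    Let [u] be the limit, [D] the distance from [u] to [T u] and [a n] the one
    from [x n] to [T u].  Bounding [a n] by [s * (d (x n) u + D)] would
    introduce a factor [s ^ 2] that the hypotheses do not control.  Instead,
    contractivity is read as the recursion
    [a n.+1 <= max (alpha * c * D, a n / 2)] up to a vanishing error, which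
    forces [a n] below [alpha * c * D] in the limit.  Then
    [D <= s * alpha * c * D], hence [D = 0], and [u] lies in the closed set
    [T u] ([fixed_point_of_orbit_limit]). *)

Import Order.TTheory GRing.Theory Num.Theory.
Import numFieldNormedType.Exports.

Set Implicit Arguments.
Unset Strict Implicit.
Unset Printing Implicit Defensive.

Local Open Scope classical_set_scope.
Local Open Scope ring_scope.

(** * Real sequences *)

Lemma cvg0_norm_lt (R : realType) (a : nat -> R) (e : R) :
  a @ \oo --> (0 : R) -> 0 < e ->
  exists N, forall n, (N <= n)%N -> `|a n| < e.
Proof.
move=> a0 e0; have [N _ HN] := cvgr0_norm_lt _ a0 _ e0.
by exists N => n Nn; exact: HN.
Qed.

Lemma exprn_small (R : realType) (k C e : R) :
  0 <= k < 1 -> 0 <= C -> 0 < e ->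
  exists N, forall n, (N <= n)%N -> C * k ^+ n < e.
Proof.
move=> /andP[k0 k1] C0 e0.
have k1' : `|k| < 1 by rewrite ger0_norm.
have [N HN] := cvg0_norm_lt (cvg_geometric C k1') e0.
by exists N => n /HN; apply: le_lt_trans; exact: ler_norm.
Qed.

(** Either the recursion enters the level [M + e] or it halves the distance to
    the fixed point [2 * e] of [t |-> t / 2 + e]; both are below
    [M + 2 * e] up to a geometrically vanishing term. *)
Lemma halving_recursion_bound (R : realType) (a : nat -> R) (M e : R) (N : nat) :
  0 <= M -> 0 < e ->
  (forall n, (N <= n)%N -> a n.+1 <= Num.max (M + e) (a n / 2 + e)) ->
  exists2 n, (N <= n)%N & a n <= M + 3 * e.
Proof.
move=> M0 e0 Ha.
have bound k : a (N + k)%N <= M + 2 * e + `|a N| * 2^-1 ^+ k.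
  elim: k => [|k IH].
    by rewrite addn0 expr0; have := ler_norm (a N); lra.
  rewrite addnS; apply: le_trans (Ha _ (leq_addr _ _)) _.
  have pos : 0 <= `|a N| * 2^-1 ^+ k by rewrite mulr_ge0// exprn_ge0// invr_ge0.
  by rewrite exprSr mulrA ge_max; apply/andP; split; lra.
have half : 0 <= (2^-1 : R) < 1 by lra.
have [K HK] := exprn_small half (normr_ge0 (a N)) e0.
exists (N + K)%N; first exact: leq_addr.
by have := bound K; have := HK K (leqnn K); lra.
Qed.

(** * Distances to sets in a b-metric space *)

Section BMetric.
Context {R : realType} {X : Type} {s : R} {d : X -> X -> R}.
Context (s_ge1 : 1 <= s) (d_bmetric : is_bmetric s d).

Let s_gt0 : 0 < s. Proof. exact: lt_le_trans ltr01 s_ge1. Qed.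

Let d_ge0 x y : 0 <= d x y. Proof. by case: d_bmetric. Qed.

Let dxx x : d x x = 0.
Proof. by case: d_bmetric => _ H _ _; apply/H. Qed.

Let dC x y : d x y = d y x. Proof. by case: d_bmetric. Qed.

Let d_triangle x y z : d x y <= s * (d x z + d z y).
Proof. by case: d_bmetric. Qed.

Lemma dist_to_set_le x c (C : set X) : C c -> dist_to_set d x C <= d x c.
Proof.
move=> Cc; apply: ge_inf; last by exists c.
by exists 0 => _ [b _ <-].
Qed.

Lemma dist_to_set_ge0 x (C : set X) : C !=set0 -> 0 <= dist_to_set d x C.
Proof.
move=> [c Cc]; apply: lb_le_inf; first by exists (d x c), c.
by move=> _ [b _ <-].
Qed.

Lemma dist_to_set_lt x e (C : set X) : C !=set0 -> dist_to_set d x C < e ->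
  exists2 c, C c & d x c < e.
Proof.
move=> [c Cc] lte.
have [|_ [b Cb <-] be] := inf_lt _ lte; first by exists (d x c), c.
by exists b.
Qed.

Lemma dist_to_set_triangle x y (C : set X) : C !=set0 ->
  dist_to_set d x C <= s * (d x y + dist_to_set d y C).
Proof.
move=> C0.
rewrite -ler_pdivrMl// -lerBlDl; apply: lb_le_inf.
  by case: C0 => c Cc; exists (d y c), c.
move=> _ [c Cc <-]; rewrite lerBlDl ler_pdivrMl//.
exact: le_trans (dist_to_set_le _ Cc) (d_triangle _ _ _).
Qed.

Lemma dist_to_set_eq0 x (C : set X) : C !=set0 -> bclosed d C ->
  dist_to_set d x C <= 0 -> C x.
Proof.
move=> C0 Ccl le0.
have close n : exists c, C c /\ d c x < n.+1%:R^-1.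
  have [|c Cc cn] := @dist_to_set_lt x n.+1%:R^-1 C C0.
    by apply: le_lt_trans le0 _; rewrite invr_gt0 ltr0n.
  by exists c; rewrite dC.
have [w Hw] := choice close.
apply: (Ccl w); first by move=> n; case: (Hw n).
apply: (@squeeze_cvgr _ _ _ _ (fun=> 0) (@harmonic R)).
- by apply: nearW => n; rewrite d_ge0 /= ltW//; case: (Hw n).
- exact: cvg_cst.
- exact: cvg_harmonic.
Qed.

(** Boundedness of both sets makes the supremum in the Hausdorff distance an
    actual upper bound. *)
Lemma dist_to_set_le_hausdorff (A B : set X) a :
  closed_bounded_sets d A -> closed_bounded_sets d B -> A a ->
  dist_to_set d a B <= hausdorff_dist d A B.
Proof.
move=> [_ [M HM] _] [[b Bb] _ _] Aa.
rewrite /hausdorff_dist le_max; apply/orP; left.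
apply: ub_le_sup; last by exists a.
exists (s * (M + d a b)) => _ [a' Aa' <-].
apply: le_trans (dist_to_set_le _ Bb) (le_trans (d_triangle _ _ a) _).
by rewrite ler_pM2l// lerD2r HM.
Qed.

(** * Sequences with geometrically decreasing steps *)

Lemma geometric_window (x : nat -> X) (k C : R) (p : nat) :
  0 <= k < 1 -> 0 <= C -> (forall n, d (x n) (x n.+1) <= C * k ^+ n) ->
  exists2 K, 0 <= K &
    forall n j, (j <= p)%N -> d (x n) (x (n + j)%N) <= K * k ^+ n.
Proof.
move=> /andP[k0 k1] C0 step; elim: p => [|p [K K0 IH]].
  by exists 0 => // n j; rewrite leqn0 => /eqP ->; rewrite addn0 dxx mul0r.
exists (s * (C + K)); first by rewrite mulr_ge0 ?addr_ge0// ltW.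
move=> n [|j] jp.
  by rewrite addn0 dxx mulr_ge0 ?exprn_ge0// mulr_ge0 ?addr_ge0// ltW.
apply: le_trans (d_triangle _ _ (x n.+1)) _.
rewrite -mulrA ler_pM2l// mulrDl.
apply: lerD; first exact: step.
rewrite addnS -addSn; apply: le_trans (IH _ _ jp) _.
by rewrite ler_wpM2l// exprS ler_piMl ?exprn_ge0// ltW.
Qed.

(** A jump of length greater than [p] is a block of length [p] followed by a
    shorter jump that starts [p] indices later.  The second part gains the
    factor [k ^+ p], which outweighs the constant [s] of the triangle
    inequality as soon as [s * k ^+ p <= 1 / 2]; so a bound
    [2 * s * K * k ^+ n] is reproduced whatever the length of the jump. *)
Lemma geometric_cauchy (x : nat -> X) (k C : R) :
  0 <= k < 1 -> 0 <= C -> (forall n, d (x n) (x n.+1) <= C * k ^+ n) ->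
  bcauchy d x.
Proof.
move=> k01 C0 step; have /andP[k0 k1] := k01.
have s1 := s_ge1; have s0 := ltW s_gt0.
have [p Hp] : exists p, s * k ^+ p.+1 < 2^-1.
  have h : (0 : R) < 2^-1 by lra.
  have [N HN] := exprn_small k01 s0 h.
  by exists N; exact/HN/leqnSn.
have [K K0 window] := geometric_window p.+1 k01 C0 step.
have sK : K <= 2 * s * K by nra.
have jump j n : d (x n) (x (n + j)%N) <= 2 * s * K * k ^+ n.
  elim/ltn_ind: j n => j IH n.
  have kn0 : 0 <= k ^+ n by exact: exprn_ge0.
  case: (leqP j p.+1) => jp.
    by apply: le_trans (window _ _ jp) _; rewrite ler_wpM2r.
  apply: le_trans (d_triangle _ _ (x (n + p.+1)%N)) _.
  have first_block := window n p.+1 (leqnn _).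
  have rest : d (x (n + p.+1)%N) (x (n + j)%N) <=
      2 * s * K * (k ^+ n * k ^+ p.+1).
    rewrite -exprD -(subnKC (ltnW jp)) addnA.
    by apply: IH; rewrite ltn_subrL /= (leq_trans _ jp).
  have rest_small : s * k ^+ p.+1 * (2 * s * K * k ^+ n) <=
      2^-1 * (2 * s * K * k ^+ n).
    by rewrite ler_wpM2r ?(ltW Hp)// !mulr_ge0.
  have := ler_wpM2l s0 (lerD first_block rest).
  by lra.
move=> e e0.
have sK0 : 0 <= 2 * s * K by rewrite !mulr_ge0.
have [N HN] := exprn_small k01 sK0 e0.
exists N => m n Nm Nn; wlog mn : m n Nm Nn / (m <= n)%N.
  move=> H; case: (leqP m n) => [|/ltnW] mn; first exact: H.
  by rewrite dC; exact: H.
rewrite -(subnKC mn); exact: le_lt_trans (jump _ _) (HN _ Nm).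
Qed.

(** * Orbits of a contractive set-valued map *)

Context {T : X -> set X} (T_values : forall x, closed_bounded_sets d (T x)).
Context {c delta alpha : R}.
Context (c_range : 0 <= c <= 1) (delta_range : 0 <= delta <= 1).
Context (alpha_range : 0 <= alpha < 1).
Context (T_contractive : forall x y : X,
  hausdorff_dist d (T x) (T y) <= alpha * Nmax d T c delta x y).

Let T_neq0 x : T x !=set0. Proof. by case: (T_values x). Qed.

Lemma dist_image_le_Nmax x y z : T x z ->
  dist_to_set d z (T y) <= alpha * Nmax d T c delta x y.
Proof.
move=> Txz; apply: le_trans (T_contractive x y).
exact: dist_to_set_le_hausdorff.
Qed.

(** For [r = delta * s] this is the slack that pays for not attaining the
    infimum distances. *)
Lemma exists_larger_factor (r : R) : alpha * r < 1 ->
  exists2 beta, alpha < beta < 1 & beta * r < 1.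
Proof.
move=> ar; have /andP[a0 a1] := alpha_range.
have [r1|r1] := leP r 1.
  by exists ((alpha + 1) / 2); [lra | nra].
have r0 : 0 < r by lra.
have ar' : alpha < r^-1 by rewrite -div1r ltr_pdivlMr.
have r'1 : r^-1 < 1 by rewrite invf_lt1.
exists ((alpha + r^-1) / 2); first lra.
by rewrite mulrAC mulrDl mulVf ?gt_eqF//; lra.
Qed.

(** If [d y z] exceeded [k * d x y], then [beta] times each of the four terms
    of [Nmax] would be at most [d y z], contradicting the choice of [z]. *)
Lemma contraction_step : alpha * delta * s < 1 ->
  exists2 k, 0 <= k < 1 &
    forall x y, T x y -> exists z, T y z /\ d y z <= k * d x y.
Proof.
rewrite -mulrA => /exists_larger_factor[beta /andP[ab b1] bds].
have /andP[a0 _] := alpha_range.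
have /andP[c0 c1] := c_range; have /andP[de0 de1] := delta_range.
have b0 : 0 < beta by lra.
exists (Num.max beta (beta * (delta * s))).
  by rewrite le_max (ltW b0) gt_max b1 bds.
set k := Num.max _ _ => x y Txy.
have bk : beta <= k by rewrite le_max lexx.
have tk : beta * (delta * s) <= k by rewrite le_max lexx orbT.
have ds0 : 0 <= delta * s by rewrite mulr_ge0// ltW.
have [xy0|xy0] := eqVneq (d x y) 0.
  (* Here [x = y], so [y] itself is a point of [T y]. *)
  have xy : x = y by case: d_bmetric => _ H _ _; apply/H.
  by exists y; rewrite dxx xy0 mulr0 lexx -{1}xy; split.
have p0 : 0 < d x y by rewrite lt_neqAle eq_sym xy0 d_ge0.
have N0 : 0 < Nmax d T c delta x y.
  by apply: lt_le_trans p0 _; rewrite /Nmax le_max lexx.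
have [z Tyz yz] : exists2 z, T y z & d y z < beta * Nmax d T c delta x y.
  apply: dist_to_set_lt => //.
  by apply: le_lt_trans (dist_image_le_Nmax _ Txy) _; rewrite ltr_pM2r.
exists z; split => //; rewrite leNgt; apply/negP => kq.
move: yz; apply/negP; rewrite -leNgt -ler_pdivlMl//.
have bpq : beta * d x y <= d y z by nra.
have q0 := d_ge0 y z.
have h1 := dist_to_set_le x Txy.
have h2 := dist_to_set_le y Tyz.
have h3 := dist_to_set_le x Tyz.
have h4 := dist_to_set_le y Txy; rewrite dxx in h4.
have h5 := d_triangle x z y.
have g1 := dist_to_set_ge0 x (T_neq0 x).
have g2 := dist_to_set_ge0 y (T_neq0 y).
rewrite /Nmax !ge_max !ler_pdivlMl//; apply/and4P; split => //.
- apply: le_trans bpq; rewrite ler_pM2l//.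
  by apply: le_trans h1; rewrite ler_piMl.
- apply: le_trans h2; rewrite mulrA ler_piMl//; nra.
- have sum_le : delta / 2 * (dist_to_set d x (T y) + dist_to_set d y (T x)) <=
      delta / 2 * (s * (d x y + d y z)) by apply: ler_wpM2l; lra.
  have tp : beta * (delta * s) * d x y <= d y z.
    by apply: le_trans (ltW kq); rewrite ler_wpM2r// ltW.
  have tq : beta * (delta * s) * d y z <= d y z by rewrite ler_piMl// ltW.
  apply: le_trans (_ : beta * (delta / 2 * (s * (d x y + d y z))) <= _).
    by rewrite ler_pM2l.
  by lra.
Qed.

Lemma exists_geometric_orbit (x0 : X) : alpha * delta * s < 1 ->
  exists x : nat -> X, (forall n, T (x n) (x n.+1)) /\ bcauchy d x.
Proof.
move=> /contraction_step[k k01 step].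
have [x1 Tx01] := T_neq0 x0.
(* Consecutive pairs carry the membership needed to choose the next point. *)
have next (q : {q : X * X | T q.1 q.2}) : {q' : {q : X * X | T q.1 q.2} |
    (sval q').1 = (sval q).2 /\
    d (sval q').1 (sval q').2 <= k * d (sval q).1 (sval q).2}.
  case: q => -[x y] /= Txy; apply: cid.
  by have [z [Tyz yz]] := step _ _ Txy; exists (exist _ (y, z) Tyz).
have [f [f0 fS]] := dependent_choice next
  (exist (fun q : X * X => T q.1 q.2) (x0, x1) Tx01).
pose x n := (sval (f n)).1.
have xS n : (sval (f n)).2 = x n.+1 by case: (fS n).
exists x; split=> [n|]; first by have := svalP (f n); rewrite xS.
apply: (geometric_cauchy k01 (d_ge0 x0 x1)) => n; rewrite mulrC.
elim: n => [|n IH]; first by rewrite -xS /x f0 mul1r.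
have [_] := fS n; rewrite !xS -/(x _) -/(x _) => /le_trans; apply.
by rewrite exprS -mulrA ler_wpM2l//; case/andP: k01.
Qed.

(** The distances [a n] from [x n] to [T u] are compared with each other, since
    passing through [u] would cost an additional factor [s]. *)
Lemma fixed_point_of_orbit_limit (x : nat -> X) (u : X) :
  alpha * c * s < 1 -> (forall n, T (x n) (x n.+1)) -> bconverges d x u ->
  T u u.
Proof.
move=> acs Tx xu.
have /andP[a0 a1] := alpha_range.
have /andP[c0 c1] := c_range; have /andP[de0 de1] := delta_range.
have [_ _ Tu_closed] := T_values u.
apply: dist_to_set_eq0 => //; rewrite leNgt; apply/negP.
set D := dist_to_set d u (T u) => D0.
have s1 := s_ge1.
have ss0 : 0 < s * s by exact: mulr_gt0.
(* The error terms below add up to at most [7 * (s * s) * eta]. *)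
pose eta := D * (1 - alpha * c * s) / (8 * (s * s)).
have eta_eq : 8 * (s * s) * eta = D * (1 - alpha * c * s).
  by rewrite /eta mulrC divfK// mulf_neq0 ?gt_eqF.
have eta0 : 0 < eta.
  by rewrite /eta divr_gt0 ?mulr_gt0// subr_gt0.
clearbody eta.
have s_eta : eta <= s * eta by rewrite ler_peMl// ltW.
have [N HN] := cvg0_norm_lt xu eta0.
have xu_lt n : (N <= n)%N -> d (x n) u < eta.
  by move=> /HN; apply: le_lt_trans; exact: ler_norm.
pose a n := dist_to_set d (x n) (T u).
have a_ge0 n : 0 <= a n by exact: dist_to_set_ge0.
have M0 : 0 <= alpha * c * D by rewrite !mulr_ge0// ltW.
have e0 : 0 < 2 * (s * eta) by rewrite !mulr_gt0.
have [n Nn|n Nn an] := @halving_recursion_bound R a _ _ N M0 e0.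
  have h0 := xu_lt _ Nn; have h1 := xu_lt _ (leqW Nn).
  have hx : dist_to_set d (x n) (T (x n)) <= 2 * (s * eta).
    apply: le_trans (dist_to_set_le _ (Tx n)) _.
    apply: le_trans (d_triangle _ _ u) _.
    have : s * (d (x n) u + d u (x n.+1)) <= s * (eta + eta).
      by rewrite ler_pM2l// (dC u) lerD// ltW.
    by lra.
  have hu : dist_to_set d u (T (x n)) <= eta.
    by apply: le_trans (dist_to_set_le _ (Tx n)) _; rewrite dC ltW.
  have hu0 := dist_to_set_ge0 u (T_neq0 (x n)).
  have hx0 := dist_to_set_ge0 (x n) (T_neq0 (x n)).
  have shrink t v w : 0 <= t -> t <= 1 -> 0 <= v -> v <= w -> t * v <= w.
    by move=> t0 t1 v0 vw; apply: le_trans vw; rewrite ler_piMl.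
  have an0 := a_ge0 n.
  apply: le_trans (dist_image_le_Nmax u (Tx n)) _.
  rewrite /Nmax -/D -/(a n) !maxr_pMr// !ge_max; apply/and4P; split.
  - rewrite le_max; apply/orP; left.
    by apply: (shrink) => //; [exact: ltW | lra].
  - rewrite le_max; apply/orP; left.
    apply: (shrink) => //; [exact: ltW | exact: mulr_ge0 |].
    by apply: (shrink) => //; lra.
  - by rewrite le_max [alpha * (c * _)]mulrA lerDl (ltW e0).
  - rewrite le_max; apply/orP; right.
    apply: (shrink) => //; [exact: ltW | |].
      by rewrite mulr_ge0 ?addr_ge0//; lra.
    have -> : delta / 2 * (a n + dist_to_set d u (T (x n))) =
      delta * ((a n + dist_to_set d u (T (x n))) / 2) by lra.
    by apply: (shrink) => //; lra.
have := dist_to_set_triangle u (x n) (T_neq0 u); rewrite -/D -/(a n) => Dle.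
have xn := xu_lt _ Nn; rewrite dC in xn.
have : s * (d u (x n) + a n) <= s * (s * eta + (alpha * c * D + 3 * (2 * (s * eta)))).
  by rewrite ler_pM2l// lerD//; lra.
have : 0 < s * s * eta by rewrite mulr_gt0.
by lra.
Qed.

End BMetric.

Unset Implicit Arguments.

Theorem theorem3p3 (R : realType) (X : Type) (X_nonempty : inhabited X)
    (s : R) (s_ge1 : 1 <= s)
    (d : X -> X -> R) (d_bmetric : is_bmetric s d) (d_complete : bcomplete d)
    (T : X -> set X) (T_values : forall x, closed_bounded_sets d (T x))
    (c delta alpha : R)
    (c_range : 0 <= c <= 1) (delta_range : 0 <= delta <= 1)
    (alpha_range : 0 <= alpha < 1)
    (T_contractive : forall x y : X,
       hausdorff_dist d (T x) (T y) <= alpha * Nmax d T c delta x y)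
    (constants_small : Num.max (alpha * c * s) (alpha * delta * s) < 1) :
  exists u : X, T u u.
Proof.
case: X_nonempty => x0.
move: constants_small; rewrite gt_max => /andP[acs ads].
have [x [Tx x_cauchy]] := exists_geometric_orbit s_ge1 d_bmetric T_values
  c_range delta_range alpha_range T_contractive x0 ads.
have [u xu] := d_complete x x_cauchy.
exists u; exact: (fixed_point_of_orbit_limit s_ge1 d_bmetric T_values
  c_range delta_range alpha_range T_contractive acs Tx xu).
Qed.
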